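(* For every fixed positive integer $k$, the problem of recognizing WTD($k$) graphs can be solved in polynomial time; that is, there is a polynomial-time algorithm which, given a graph $G$ with no isolated vertices, decides whether $G$ is a WTD($k$) graph.
   Context: Graphs are finite and simple. Let $G$ be a graph with no isolated vertices. A set $S\subseteq V(G)$ is a total dominating set (TDS) of $G$ if every vertex of $G$ is adjacent to at least one element of $S$. A TDS is minimal if it contains no other TDS of $G$. The total domination number $\gamma_t(G)$ is the minimum size of a TDS of $G$, and the upper total domination number $\Gamma_t(G)$ is the maximum size of a minimal TDS of $G$. $G$ is well-totally-dominated (WTD) if every minimal TDS of $G$ has the same size, i.e. $\gamma_t(G)=\Gamma_t(G)$. A WTD($k$) graph is a WTD graph $G$ with $\gamma_t(G)=k$. Polynomial time means polynomial in the size of $G$, with $k$ a fixed constant. *)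

(* Defs.v *)
From mathcomp Require Import all_boot all_order all_algebra.

Set Implicit Arguments.
Unset Strict Implicit.
Unset Printing Implicit Defensive.

Record sgraph := SGraph {
  order : nat;
  adj : rel 'I_order;
  adj_sym : symmetric adj;
  adj_irrefl : irreflexive adj
}.

Notation vertex G := 'I_(order G).

Definition no_isolated (G : sgraph) : bool :=
  [forall v : vertex G, exists u : vertex G, adj v u].

Definition tds (G : sgraph) (S : {set vertex G}) : bool :=
  [forall v : vertex G, exists u in S, adj v u].

Definition min_tds (G : sgraph) (S : {set vertex G}) : bool :=
  minset (@tds G) S.

(* When G has no isolated vertex, [set: vertex G] is a TDS, so the arg min is
   a genuine minimum; otherwise gamma_t is a junk value. *)
Definition gamma_t (G : sgraph) : nat :=
  #|[arg min_(S < [set: vertex G] | tds S) #|S|]|.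

Definition wtd (G : sgraph) : bool :=
  [forall S1 : {set vertex G}, forall S2 : {set vertex G},
     min_tds S1 ==> min_tds S2 ==> (#|S1| == #|S2|)].

Definition wtdk (k : nat) (G : sgraph) : bool := wtd G && (gamma_t G == k).

(* The adjacency matrix written row by row, over the three-letter alphabet
   option bool: Some b is a matrix entry and None terminates a row. *)
Definition encode (G : sgraph) : seq (option bool) :=
  flatten [seq rcons [seq Some (adj u v) | v <- enum (vertex G)] None
          | u <- enum (vertex G)].

(* Deterministic multi-tape Turing machines with input alphabet A.  There are
   nwork work tapes besides the input tape (tape ord0); all tapes are two-way
   infinite and writable. *)

(* Tape symbols: None is the blank, inl an input letter, inr a work letter. *)
Definition cell (A W : finType) : finType := option (A + W).

Inductive move := MLeft | MStay | MRight.

Definition displacement (m : move) : int :=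
  match m with MLeft => (-1)%R | MStay => 0%R | MRight => 1%R end.

(* A state q halts iff verdict q = Some b, and then the answer is b. *)
Record tm (A : finType) := TM {
  nwork : nat;
  work : finType;
  state : finType;
  start : state;
  verdict : state -> option bool;
  delta : state -> {ffun 'I_nwork.+1 -> cell A work} ->
          state * ('I_nwork.+1 -> cell A work * move)
}.

Record config (A : finType) (M : tm A) := Config {
  cstate : state M;
  content : 'I_(nwork M).+1 -> int -> cell A (work M);
  head : 'I_(nwork M).+1 -> int
}.

(* The input occupies the cells 0, 1, ..., size w - 1 of the input tape, all
   other cells are blank, and all heads are on cell 0. *)
Definition init (A : finType) (M : tm A) (w : seq A) : config M :=
  Config (start M)
    (fun i z => match z with
                | Posz p => if i == ord0 then omap inl (onth w p) else None
                | Negz _ => None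
                end)
    (fun=> 0%R).

Definition scan (A : finType) (M : tm A) (c : config M)
    : {ffun 'I_(nwork M).+1 -> cell A (work M)} :=
  [ffun i => content c i (head c i)].

(* Halting configurations are fixed by step. *)
Definition step (A : finType) (M : tm A) (c : config M) : config M :=
  if verdict (cstate c) is Some _ then c else
  let: (q, act) := delta (cstate c) (scan c) in
  Config q
    (fun i z => if z == head c i then (act i).1 else content c i z)
    (fun i => (head c i + displacement (act i).2)%R).

(* Some b iff M halts on w within t steps with answer b. *)
Definition answer (A : finType) (M : tm A) (w : seq A) (t : nat) : option bool :=
  verdict (cstate (iter t (@step A M) (init M w))).

(* The problem P on the instances satisfying the promise, presented through
   the encoding enc, is solved by a Turing machine in time polynomial in the
   length of the encoded instance. *)
Definition poly_time_decidable (A : finType) (X : Type) (enc : X -> seq A)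
    (promise P : pred X) : Prop :=
  exists (M : tm A) (c d : nat), forall x : X, promise x ->
    answer M (enc x) (c * size (enc x) ^ d + c) = Some (P x).

(* Main.v *)
Require Import Defs.
From mathcomp Require Import all_boot all_order all_algebra.
From mathcomp Require Import zify.

(* A graph without isolated vertices is WTD(k) iff it is nonempty, has no total
   dominating set of size less than k and no minimal one of size more than k.
   The last condition has a certificate of fixed size: there is a minimal total
   dominating set with more than k elements iff there are f_0, ..., f_k and
   g_0, ..., g_k such that g_i is adjacent to f_j exactly when i = j, and every
   vertex is adjacent to some f_i or to a vertex outside the neighbourhoods of
   all the g_i: the f_i and the vertices outside these neighbourhoods then form
   a total dominating set, and a minimal one inside it must keep every f_i, of
   which g_i is a private neighbour.  Conversely, any k + 1 elements of a minimal
   set have private neighbours, and the other elements of the set lie outside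
   their neighbourhoods.

   Being a WTD(k) graph is thus a first-order property of graphs, with a number
   of quantifiers depending only on k.  Such a property is decided in polynomial
   time by an automaton with several two-way heads on the adjacency matrix,
   built by induction on the formula; a Turing machine simulates the automaton
   by first copying its input to one tape per head. *)

Set Implicit Arguments.
Unset Strict Implicit.
Unset Printing Implicit Defensive.

(** * Automata with several two-way heads *)

Definition letter_at (A : Type) (w : seq A) (z : int) : option A :=
  if z is Posz p then onth w p else None.

(** The heads only read. A transition to [inr b] halts with answer [b] but still performs its moves,
    so a gadget can put its heads back in place with its last step. *)
Record automaton (A H : finType) := Automaton {
  astate : finType;
  astart : astate;
  adelta : astate -> {ffun H -> option A} -> (astate + bool) * (H -> move)
}.

Definition aconfig (A H : finType) (M : automaton A H) : Type :=
  (astate M + bool) * {ffun H -> int}.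

Definition astep (A H : finType) (M : automaton A H) (w : seq A)
    (c : aconfig M) : aconfig M :=
  if c.1 is inl q then
    let: (s, mv) := adelta q [ffun i => letter_at w (c.2 i)] in
    (s, [ffun i => (c.2 i + displacement (mv i))%R])
  else c.

(** [T] is only an upper bound on the number of steps, so that bounds can be weakened and added
    without exact counting. *)
Inductive reach (A H : finType) (M : automaton A H) (w : seq A) :
    nat -> aconfig M -> aconfig M -> Prop :=
| reach_refl T c : reach w T c c
| reach_step T q h c :
    reach w T (astep w (inl q, h)) c -> reach w T.+1 (inl q, h) c.

Section Reach.
Variables (A H : finType) (M : automaton A H) (w : seq A).
Implicit Types (c : aconfig M) (h : {ffun H -> int}).

Lemma reach_mono T T' c c' : reach w T c c' -> T <= T' -> reach w T' c c'.
Proof.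
move=> cc'; elim: cc' T' => [T0 c0 T' _|T0 q h c0 _ IH [//|T'] ?].
  exact: reach_refl.
by apply: reach_step; apply: IH.
Qed.

Lemma reach_trans T1 T2 c1 c2 c3 :
  reach w T1 c1 c2 -> reach w T2 c2 c3 -> reach w (T1 + T2) c1 c3.
Proof.
elim=> [T0 c0 c03|T0 q h c0 _ IH c03]; first exact: reach_mono (leq_addl _ _).
by rewrite addSn; apply: reach_step; apply: IH.
Qed.

Lemma reach_iter T c b h :
  reach w T c (inr b, h) -> iter T (@astep A H M w) c = (inr b, h).
Proof.
have stop T0 : iter T0 (@astep A H M w) (inr b, h) = (inr b, h).
  by elim: T0 => //= T0 ->.
move E: (inr b, h) => c' cc'; elim: cc' E => [T0 c0 <- //|T0 q h0 c0 _ IH E].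
by rewrite iterSr IH.
Qed.

Lemma reach_move T q h s mv h' c :
    adelta q [ffun i => letter_at w (h i)] = (s, mv) ->
    (forall i, h' i = (h i + displacement (mv i))%R) ->
  reach w T (s, h') c -> reach w T.+1 (inl q, h) c.
Proof.
move=> dq Eh' sc; apply: reach_step; rewrite /astep /= dq.
suff -> : [ffun i => (h i + displacement (mv i))%R] = h' by [].
by apply/ffunP => i; rewrite ffunE.
Qed.

(** Handles a whole scan at once: a gadget only has to know the letters met along the way, and the
    induction on the number of steps is done here. *)
Lemma reach_loop m T q h mv h' c :
    (forall j, j < m ->
      adelta q [ffun i => letter_at w (h i + displacement (mv i) * j%:Z)%R]
      = (inl q, mv)) ->
    (forall i, h' i = (h i + displacement (mv i) * m%:Z)%R) ->
  reach w T (inl q, h') c -> reach w (m + T) (inl q, h) c.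
Proof.
elim: m h => [|m IH] h loop Eh' qc.
  suff -> : h = h' by [].
  by apply/ffunP => i; rewrite Eh' GRing.mulr0 GRing.addr0.
rewrite addSn; apply: (@reach_move _ _ _ (inl q) mv
  [ffun i => (h i + displacement (mv i))%R]) => [|i|].
- rewrite -(loop 0) //; congr (adelta _ _); apply/ffunP => i.
  by rewrite !ffunE GRing.mulr0 GRing.addr0.
- by rewrite ffunE.
apply: IH => [j ltj|i|//]; last first.
  by rewrite Eh' ffunE -GRing.addrA intS GRing.mulrDr GRing.mulr1.
rewrite -(loop j.+1) //; congr (adelta _ _); apply/ffunP => i.
by rewrite !ffunE intS GRing.mulrDr GRing.mulr1 GRing.addrA.
Qed.

End Reach.

Section Embedding.
Variables (A H : finType) (M M' : automaton A H) (w : seq A).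
Variables (f : astate M -> astate M') (e : bool -> astate M' + bool).

(** [M] runs as a subroutine of [M']: a halt with answer [b] becomes the jump or halt [e b] within
    the same step, so the time bound of [M] carries over unchanged. *)
Definition embed (s : astate M + bool) : astate M' + bool :=
  match s with inl q => inl (f q) | inr b => e b end.

Hypothesis embed_delta : forall q rd,
  adelta (f q) rd = (embed (adelta q rd).1, (adelta q rd).2).

Lemma reach_embed T s h s' h' :
  reach (M := M) w T (s, h) (s', h') ->
  reach (M := M') w T (embed s, h) (embed s', h').
Proof.
move E: (s, h) => c; move E': (s', h') => c' cc'.
elim: cc' s h E E' => [T0 c0 s h <- [-> ->]|T0 q h0 c0 _ IH s h [-> ->] E'].
  exact: reach_refl.
apply: reach_step; rewrite /astep /= embed_delta.
by apply: IH E'; rewrite /astep /=; case: (adelta _ _).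
Qed.

End Embedding.

(** * The adjacency matrix as a word *)

Definition adj_row (n : nat) (r : rel nat) (u : nat) : seq (option bool) :=
  rcons [seq Some (r u v) | v <- iota 0 n] None.

Definition rows (n : nat) (r : rel nat) : seq (option bool) :=
  flatten [seq adj_row n r u | u <- iota 0 n].

Section Rows.
Variables (n : nat) (r : rel nat).

Lemma size_flatten_rows s :
  size (flatten [seq adj_row n r u | u <- s]) = size s * n.+1.
Proof.
by elim: s => //= u s IH; rewrite size_cat IH size_rcons size_map size_iota.
Qed.

Lemma size_rows : size (rows n r) = n * n.+1.
Proof. by rewrite size_flatten_rows size_iota. Qed.

Lemma onth_rows u i : u < n -> i <= n ->
  onth (rows n r) (u * n.+1 + i) = onth (adj_row n r u) i.
Proof.
move=> ltun lein; have En : n = u + (n - u.+1).+1 by lia.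
rewrite /rows [X in iota 0 X]En iotaD map_cat flatten_cat add0n /=.
rewrite onth_cat size_flatten_rows size_iota ltnNge leq_addr /= addKn.
by rewrite onth_cat /= size_rcons size_map size_iota ltnS lein.
Qed.

Lemma rows_entry u v : u < n -> v < n ->
  letter_at (rows n r) (u * n.+1 + v)%N = Some (Some (r u v)).
Proof.
move=> ltun ltvn; rewrite /= onth_rows ?(ltnW ltvn)// /adj_row -cats1 onth_cat.
rewrite size_map size_iota ltvn onth_map.
case E: (onth _ _) (onthTE (iota 0 n) v) => [a|];
  rewrite size_iota ltvn // => _.
by move: (@onth_nth _ 0 _ _ _ E); rewrite nth_iota // add0n => <-.
Qed.

Lemma rows_eol u : u < n -> letter_at (rows n r) (u * n.+1 + n)%N = Some None.
Proof.
move=> ltun; rewrite /= onth_rows // /adj_row -cats1 onth_cat.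
by rewrite size_map size_iota ltnn subnn.
Qed.

Lemma rows_end p : n * n.+1 <= p -> letter_at (rows n r) p = None.
Proof. by move=> ?; rewrite /= onth_default // size_rows. Qed.

Lemma rows_inside p : p < n * n.+1 -> letter_at (rows n r) p != None.
Proof.
by move=> ltp; have := onthTE (rows n r) p; rewrite /= size_rows ltp; case: onth.
Qed.

End Rows.

(** * Automata for the first-order connectives *)

(* The value [u] of a variable [x] is stored in two heads: the row head [(x, true)]
   is at the start of row [u] of the matrix, the column head [(x, false)] is at
   column [u] of row 0. *)
Definition pos (V : finType) (n : nat) (e : {ffun V -> nat}) :
    {ffun V * bool -> int} :=
  [ffun i => if i.2 then Posz (e i.1 * n.+1) else Posz (e i.1)].

Definition upd (V : finType) (e : {ffun V -> nat}) (x : V) (a : nat) :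
    {ffun V -> nat} :=
  [ffun v => if v == x then a else e v].

Definition move2 (H : finType) (a : H) (m : move) (b : H) (m' : move) (i : H) :
    move :=
  if i == a then m else if i == b then m' else MStay.

Section Gadgets.
Variable V : finType.

Notation gadget := (automaton (option bool) (V * bool)%type).
Notation reads := {ffun V * bool -> option (option bool)}.

Definition const_gadget (b : bool) : gadget :=
  @Automaton (option bool) (V * bool)%type unit tt
    (fun _ _ => (inr b, fun=> MStay)).

Section Connectives.
Variables M M' : gadget.

Definition not_gadget : gadget :=
  @Automaton (option bool) (V * bool)%type (astate M) (astart M)
    (fun q rd => let: (s, mv) := adelta q rd in
      (match s with inl q => inl q | inr b => inr (~~ b) end, mv)).

Definition and_delta (q : astate M + astate M') (rd : reads) :
    (astate M + astate M' + bool) * (V * bool -> move) :=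
  match q with
  | inl q => let: (s, mv) := adelta q rd in
      (match s with
       | inl q => inl (inl q)
       | inr b => if b then inl (inr (astart M')) else inr false
       end, mv)
  | inr q => let: (s, mv) := adelta q rd in
      (match s with inl q => inl (inr q) | inr b => inr b end, mv)
  end.

Definition and_gadget : gadget :=
  @Automaton (option bool) (V * bool)%type (astate M + astate M')%type
    (inl (astart M)) and_delta.

End Connectives.

Section Adjacency.
Variables x y : V.

(* Moving the column head of [y] back past cell 0 while the row head of [x] moves
   forward leads the latter to entry [(x, y)]; both are then brought back by
   moving the row head to the end of the previous row. *)
Definition adj_delta (q : option (option bool)) (rd : reads) :
    (option (option bool) + bool) * (V * bool -> move) :=
  let fwd := move2 (x, true) MRight (y, false) MLeft in
  let bwd := move2 (x, true) MLeft (y, false) MRight in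
  match q with
  | None =>
      if rd (y, false) is Some _ then (inl None, fwd)
      else (inl (Some None), bwd)
  | Some None =>
      (inl (Some (if rd (x, true) is Some (Some b) then Some b else Some false)),
       fun=> MStay)
  | Some (Some b) =>
      if rd (x, true) is Some (Some _) then (inl q, bwd) else (inr b, fwd)
  end.

Definition adj_gadget : gadget :=
  @Automaton (option bool) (V * bool)%type (option (option bool)) None adj_delta.

Lemma adj_gadget_reach n r (e : {ffun V -> nat}) : e x < n -> e y < n ->
  reach (M := adj_gadget) (rows n r) (3 * n.+1) (inl None, pos n e)
    (inr (r (e x) (e y)), pos n e).
Proof.
move=> ltx lty.
pose h (j : int) : {ffun V * bool -> int} := [ffun i =>
  (pos n e i + displacement (move2 (x, true) MRight (y, false) MLeft i) * j)%R].
have hx (j : int) : h j (x, true) = (Posz (e x * n.+1) + j)%R.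
  by rewrite !ffunE /move2 eqxx /= GRing.mul1r.
have hy (j : int) : h j (y, false) = (Posz (e y) - j)%R.
  by rewrite !ffunE /move2 /= xpair_eqE andbF eqxx /=; lia.
have neg (z : int) : (z < 0)%R -> letter_at (rows n r) z = None by case: z.
have pos_letter v : v < n -> letter_at (rows n r) (Posz v) != None.
  by move=> ltv; apply: rows_inside; nia.
have disp_bwd i : displacement (move2 (x, true) MLeft (y, false) MRight i)
    = (- displacement (move2 (x, true) MRight (y, false) MLeft i))%R.
  by rewrite /move2; do 2 case: eqP => // _.
apply: (@reach_mono _ _ _ _ ((e y).+1 + ((e y).+1 + 3))); last by lia.
apply: (@reach_loop _ _ _ _ _ _ _ _ (move2 (x, true) MRight (y, false) MLeft)
  (h (e y).+1)) => [j ltj|i|].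
- rewrite /= ffunE.
  have := hy (Posz j); rewrite ffunE => ->.
  have -> : (Posz (e y) - Posz j)%R = Posz (e y - j) by lia.
  have /pos_letter : e y - j < n by lia.
  by case: letter_at.
- by rewrite ffunE.
(* The column head notices the end of its countdown only at cell -1, when the row head is one cell
   past entry [e y]; hence one step back before reading. *)
rewrite addnS.
apply: (@reach_move _ _ adj_gadget _ _ _ _ (inl (Some None))
  (move2 (x, true) MLeft (y, false) MRight) (h (e y))) => [|i|].
- by rewrite /= ffunE hy neg //; lia.
- by rewrite disp_bwd !ffunE; lia.
rewrite addnS.
apply: (@reach_move _ _ adj_gadget _ _ _ _ (inl (Some (Some (r (e x) (e y)))))
  (fun=> MStay) (h (e y))) => [|i|].
- rewrite /= ffunE hx.
  have -> : (Posz (e x * n.+1) + e y)%R = Posz (e x * n.+1 + e y) by lia.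
  by rewrite rows_entry.
- by rewrite GRing.addr0.
apply: (@reach_loop _ _ _ _ _ _ _ _ (move2 (x, true) MLeft (y, false) MRight)
  (h (-1)%R)) => [j ltj|i|].
- rewrite /= ffunE disp_bwd ffunE.
  have -> : (pos n e (x, true) +
      displacement (move2 (x, true) MRight (y, false) MLeft (x, true)) * Posz (e y)
    + - displacement (move2 (x, true) MRight (y, false) MLeft (x, true)) * Posz j)%R
    = h (Posz (e y) - Posz j)%R (x, true).
    by rewrite [h _ _]ffunE GRing.mulrBr GRing.mulNr GRing.addrA.
  rewrite hx.
  have -> : (Posz (e x * n.+1) + (Posz (e y) - Posz j))%R
    = Posz (e x * n.+1 + (e y - j)) by lia.
  by rewrite rows_entry //; lia.
- by rewrite disp_bwd !ffunE; lia.
apply: (@reach_move _ _ adj_gadget _ _ _ _ (inr (r (e x) (e y)))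
  (move2 (x, true) MRight (y, false) MLeft) (pos n e)) => [|i|].
- rewrite /= ffunE hx.
  (* The scan back ends one cell before row [e x]: on the terminator of the previous row, or on cell
     -1 when [e x] is 0. Neither holds a matrix entry, and the last move returns to the start of the
     row. *)
  case E: (e x) ltx => [|u] ltu; first by rewrite neg //; lia.
  have -> : (Posz (u.+1 * n.+1) + -1)%R = Posz (u * n.+1 + n) by lia.
  by rewrite rows_eol //; lia.
- by rewrite [h _ _]ffunE GRing.mulrN1 GRing.subrK.
exact: reach_refl.
Qed.

End Adjacency.

Section Existential.
Variables (x : V) (M : gadget).

(* [None] tests for the end of the range of [x]; [Some None] moves on to the next
   value of [x]; the states [Some (Some (b, i))], [i = 0, 1, 2], bring the heads
   of [x] back to cell 0 and then exit with [b]. *)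
Definition ex_state : finType :=
  (option (option (bool * 'I_3)) + astate M)%type.

Definition ex_delta (q : ex_state) (rd : reads) :
    (ex_state + bool) * (V * bool -> move) :=
  let R := (x, true) in let C := (x, false) in
  let rewind b i := inl (inl (Some (Some (b, inord i)))) in
  match q with
  | inr q => let: (s, mv) := adelta q rd in
      (match s with
       | inl q => inl (inr q)
       | inr b => if b then rewind true 0 else inl (inl (Some None))
       end, mv)
  | inl None =>
      (if rd R is Some _ then inl (inr (astart M)) else rewind false 0,
       fun=> MStay)
  | inl (Some None) =>
      if rd R is Some (Some _) then (inl q, move2 R MRight C MStay)
      else (inl (inl None), move2 R MRight C MRight)
  | inl (Some (Some (b, i))) =>
      match val i with
      | 0 => (rewind b 1, move2 R MLeft C MLeft)
      | 1 => if rd R is Some _ then (inl q, move2 R MLeft C MStay)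
             else (rewind b 2, move2 R MRight C MStay)
      | _ => if rd C is Some _ then (inl q, move2 R MStay C MLeft)
             else (inr b, move2 R MStay C MRight)
      end
  end.

Definition ex_gadget : gadget :=
  @Automaton (option bool) (V * bool)%type ex_state (inl None) ex_delta.

Lemma pos_upd n (e : {ffun V -> nat}) a i : pos n (upd e x a) i =
  if i == (x, true) then Posz (a * n.+1) else
  if i == (x, false) then Posz a else pos n e i.
Proof.
by case: i => v [] /=; rewrite !ffunE !xpair_eqE /= ?andbT ?andbF; case: eqP.
Qed.

(** The first move is unconditional because at [a = n] the row head is past the end of the word,
    where it reads the same [None] that marks the left end. *)
Lemma ex_rewind n r (e : {ffun V -> nat}) a b : a <= n ->
  reach (M := ex_gadget) (rows n r) (2 * n.+2 ^ 2)
    (inl (inl (Some (Some (b, inord 0)))), pos n (upd e x a))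
    (inr b, pos n (upd e x 0)).
Proof.
move=> lean.
have xC : ((x, false) == (x, true)) = false by rewrite xpair_eqE andbF.
have neg (z : int) : (z < 0)%R -> letter_at (rows n r) z = None by case: z.
pose h p q : {ffun V * bool -> int} := [ffun i =>
  if i == (x, true) then p else if i == (x, false) then q else pos n e i].
apply: (@reach_mono _ _ _ _ (a * n.+1 + (a + 3)).+1); last by nia.
apply: (@reach_move _ _ ex_gadget _ _ _ _
  (inl (inl (Some (Some (b, inord 1))))) (move2 (x, true) MLeft (x, false) MLeft)
  (h (Posz (a * n.+1) - 1)%R (Posz a - 1)%R)) => [|i|].
- by rewrite /= inordK.
- rewrite pos_upd ffunE /move2; do 2 case: ifP => // _.
  by rewrite GRing.addr0.
apply: (@reach_loop _ _ _ _ _ _ _ _ (move2 (x, true) MLeft (x, false) MStay)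
  (h (-1)%R (Posz a - 1)%R)) => [j ltj|i|].
- rewrite /= inordK // !ffunE /move2 eqxx /=.
  have -> : (Posz (a * n.+1) - 1 + -1 * Posz j)%R = Posz (a * n.+1 - j.+1).
    by lia.
  have: letter_at (rows n r) (Posz (a * n.+1 - j.+1)) != None.
    by apply: rows_inside; nia.
  by case: letter_at.
- by rewrite !ffunE /move2; case: ifP => _ /=; first lia; case: ifP => _ /=; lia.
rewrite addnS.
apply: (@reach_move _ _ ex_gadget _ _ _ _
  (inl (inl (Some (Some (b, inord 2))))) (move2 (x, true) MRight (x, false) MStay)
  (h 0%R (Posz a - 1)%R)) => [|i|].
- by rewrite /= inordK // !ffunE eqxx neg.
- by rewrite !ffunE /move2; case: ifP => _ /=; first lia; case: ifP => _ /=; lia.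
apply: (@reach_loop _ _ _ _ _ _ _ _ (move2 (x, true) MStay (x, false) MLeft)
  (h 0%R (-1)%R)) => [j ltj|i|].
- rewrite /= inordK // !ffunE /move2 xC eqxx /=.
  have -> : (Posz a - 1 + -1 * Posz j)%R = Posz (a - j.+1) by lia.
  have: letter_at (rows n r) (Posz (a - j.+1)) != None.
    by apply: rows_inside; nia.
  by case: letter_at.
- by rewrite !ffunE /move2; case: ifP => _ /=; first lia; case: ifP => _ /=; lia.
apply: (@reach_move _ _ ex_gadget _ _ _ _ (inr b)
  (move2 (x, true) MStay (x, false) MRight) (pos n (upd e x 0))) => [|i|].
- by rewrite /= inordK // !ffunE xC eqxx neg.
- by rewrite pos_upd [h _ _ _]ffunE /move2;
  case: ifP => _ /=; first lia; case: ifP => _ /=; lia.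
exact: reach_refl.
Qed.

Lemma ex_advance n r (e : {ffun V -> nat}) a : a < n ->
  reach (M := ex_gadget) (rows n r) n.+1
    (inl (inl (Some None)), pos n (upd e x a))
    (inl (inl None), pos n (upd e x a.+1)).
Proof.
move=> ltan.
pose h p q : {ffun V * bool -> int} := [ffun i =>
  if i == (x, true) then p else if i == (x, false) then q else pos n e i].
rewrite -addn1.
apply: (@reach_loop _ _ _ _ _ _ _ _ (move2 (x, true) MRight (x, false) MStay)
  (h (Posz (a * n.+1 + n)) (Posz a))) => [j ltj|i|].
- rewrite /= !ffunE /move2 !eqxx /=.
  by rewrite mul1n; have /= -> := rows_entry r ltan ltj.
- by rewrite pos_upd [h _ _ _]ffunE /move2;
  case: ifP => _ /=; first lia; case: ifP => _ /=; lia.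
apply: (@reach_move _ _ ex_gadget _ _ _ _ (inl (inl None))
  (move2 (x, true) MRight (x, false) MRight) (pos n (upd e x a.+1))) => [|i|].
- by rewrite /= !ffunE eqxx rows_eol.
- by rewrite pos_upd [h _ _ _]ffunE /move2;
  case: ifP => _ /=; first lia; case: ifP => _ /=; lia.
exact: reach_refl.
Qed.

(** The body leaves the heads where it found them, so its runs can follow one another. Each value
    costs one test, one run of the body and [n.+1] steps to advance; a single rewind ends the
    search. *)
Lemma ex_gadget_reach n r (e : {ffun V -> nat}) T P : e x = 0 ->
    (forall a, a < n -> reach (M := M) (rows n r) T
       (inl (astart M), pos n (upd e x a)) (inr (P a), pos n (upd e x a))) ->
  reach (M := ex_gadget) (rows n r) (n * (T + n.+2) + 2 * n.+2 ^ 2 + 1)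
    (inl (inl None), pos n e) (inr (has P (iota 0 n)), pos n e).
Proof.
move=> ex0 body.
have -> : pos n e = pos n (upd e x 0).
  congr pos; apply/ffunP => v; rewrite ffunE.
  by case: eqP => // ->.
suff loop m a : a + m = n ->
    reach (M := ex_gadget) (rows n r) (m * (T + n.+2) + 2 * n.+2 ^ 2 + 1)
    (inl (inl None), pos n (upd e x a))
    (inr (has P (iota a m)), pos n (upd e x 0)) by exact: loop.
elim: m a => [|m IH] a En.
  rewrite addn1.
  apply: (@reach_move _ _ ex_gadget _ _ _ _ 
    (inl (inl (Some (Some (false, inord 0))))) (fun=> MStay) (pos n (upd e x a))) => [|i|].
  - by rewrite /= ffunE pos_upd eqxx rows_end //; nia.
  - by rewrite GRing.addr0.
  by apply: ex_rewind; lia.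
have ltan : a < n by lia.
pose e' b := if b then inl (inl (Some (Some (true, inord 0))))
  else inl (inl (Some None)) : ex_state + bool.
have embed_body q rd : adelta (inr q : astate ex_gadget) rd
    = (embed (M := M) (M' := ex_gadget) inr e' (adelta q rd).1, (adelta q rd).2).
  by rewrite /=; case: (adelta _ _) => -[q'|[]].
have /= body' := reach_embed embed_body (body a ltan).
pose T0 := m * (T + n.+2) + 2 * n.+2 ^ 2 + 1 + n.+1.
apply: (@reach_mono _ _ _ _ (T + T0).+1); last by rewrite /T0; lia.
apply: (@reach_move _ _ ex_gadget _ _ _ _ (inl (inr (astart M)))
  (fun=> MStay) (pos n (upd e x a))) => [|i|].
- rewrite /= ffunE pos_upd eqxx.
  have: letter_at (rows n r) (Posz (a * n.+1)) != None.
    by apply: rows_inside; nia.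
  by case: letter_at.
- by rewrite GRing.addr0.
apply: reach_trans body' _.
rewrite /T0 /=; case: (P a) => /=.
  apply: reach_mono (ex_rewind _ _ _ _) _ => //; lia.
rewrite addnC; apply: reach_trans (ex_advance _ _ _) _ => //.
by apply: IH; lia.
Qed.

End Existential.

End Gadgets.

(** * Simulation by a Turing machine *)

Section Compilation.
Variables (A H : finType) (M : automaton A H).

Definition uncell (a : cell A void) : option A :=
  if a is Some (inl a) then Some a else None.

Definition compiled_state : finType := (bool + (astate M + bool))%type.

Definition compiled_delta (q : compiled_state)
    (sc : {ffun 'I_(#|H|).+1 -> cell A void}) :
    compiled_state * ('I_(#|H|).+1 -> cell A void * move) :=
  match q with
  | inl true =>
      if sc ord0 is Some _ then (inl true, fun=> (sc ord0, MRight))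
      else (inl false, fun i => (sc i, MLeft))
  | inl false =>
      if sc ord0 is Some _ then (inl false, fun i => (sc i, MLeft))
      else (inr (inl (astart M)), fun i => (sc i, MRight))
  | inr (inl q) =>
      let: (s, mv) :=
        adelta q [ffun x => uncell (sc (lift ord0 (enum_rank x)))] in
      (inr s, fun i =>
         (sc i, if unlift ord0 i is Some j then mv (enum_val j) else MStay))
  | inr (inr b) => (q, fun i => (sc i, MStay))
  end.

(* State [inl true] copies the input to all the tapes, [inl false] rewinds them,
   and from then on tape [lift ord0 (enum_rank x)] carries head [x]. *)
Definition compile : tm A :=
  @TM A #|H| void compiled_state (inl true)
    (fun q => if q is inr (inr b) then Some b else None) compiled_delta.

Variable w : seq A.

Definition input_cell (z : int) : cell A void := omap inl (letter_at w z).

Lemma letter_in p : p < size w -> letter_at w (Posz p) != None.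
Proof. by move=> ltp; have := onthTE w p; rewrite /= ltp; case: onth. Qed.

Lemma letter_out p : size w <= p -> letter_at w (Posz p) = None.
Proof. exact: onth_default. Qed.

Lemma copy_phase j : j <= size w ->
  let c := iter j (@step A compile) (init compile w) in
  [/\ cstate c = inl true, forall i, Defs.head c i = Posz j &
    forall i z, content c i z =
      if (i == ord0) || (z < Posz j)%R then input_cell z else None].
Proof.
elim: j => [_|j IH ltj].
  by split=> //= i [p|p] /=; rewrite /input_cell /=; case: ifP; case: eqP.
move: (IH (ltnW ltj)); rewrite iterS; case: (iter j _ _) => q con hd /=.
case=> -> Eh Ec; rewrite /step /= ffunE /= Ec eqxx /= Eh.
have Ex : input_cell j = omap inl (letter_at w j) by [].
have := letter_in ltj; case Ea: (letter_at w j) => [a|//] _.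
rewrite Ex Ea /=; split=> // [i|i z].
  by rewrite Eh; lia.
rewrite Eh Ec; have [->|nez] := eqVneq z (Posz j).
  by rewrite Ex Ea /= ifT //; apply/orP; right; lia.
by congr (if _ || _ then _ else _); lia.
Qed.

(** The first of the [m.+1] steps is the turn on the blank after the input, and [m = size w] leaves
    the heads on cell -1, where the blank before the input is seen. *)
Lemma rewind_phase m : m <= size w ->
  let c := iter m.+1 (@step A compile)
    (iter (size w) (@step A compile) (init compile w)) in
  [/\ cstate c = inl false,
      forall i, Defs.head c i = (Posz (size w) - Posz m.+1)%R &
    forall i z, content c i z = input_cell z].
Proof.
elim: m => [_|m IH ltm].
  have /= := copy_phase (leqnn (size w)).
  case: (iter (size w) _ _) => q con hd /=.
  case=> -> Eh Ec; rewrite /step /= ffunE /= Ec eqxx /= Eh.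
  have Ex : input_cell (size w) = None by rewrite /input_cell letter_out.
  rewrite Ex /=; split=> // [i|i z]; first by rewrite Eh.
  rewrite ffunE /= !Ec Eh; case: eqP => [->|nez].
    by rewrite Ex; case: ifP.
  case: (i == _) => //=; case: ifP => // /negbT nlt.
  have lez : (Posz (size w) <= z)%R by lia.
  case: z nez lez {nlt} => // p nep lep.
  by rewrite /input_cell letter_out // -lez_nat.
move: (IH (ltnW ltm)); rewrite [iter m.+2 _ _]iterS.
case: (iter m.+1 _ _) => q con hd /=.
case=> -> Eh Ec; rewrite /step /= ffunE /= Ec Eh.
have -> : (Posz (size w) - Posz m.+1)%R = Posz (size w - m.+1) by lia.
have : letter_at w (size w - m.+1)%N != None by rewrite letter_in //; lia.
rewrite /input_cell; case: (letter_at w _) => [a _|//] /=.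
split=> // [i|i z]; first by rewrite Eh; lia.
by rewrite ffunE /= Ec; case: eqP => [->|_].
Qed.

Definition simulates (c : config compile) (s : aconfig M) : Prop :=
  [/\ cstate c = inr s.1,
      forall x, Defs.head c (lift ord0 (enum_rank x)) = s.2 x &
      forall i z, content c i z = input_cell z].

(** Copying takes [size w] steps, rewinding to cell -1 takes [size w + 1], and one more step brings
    the heads to cell 0. *)
Lemma simulates_start :
  simulates
    (iter (2 * (size w).+1) (@step A compile) (init compile w))
    (inl (astart M), [ffun=> Posz 0]).
Proof.
have -> : 2 * (size w).+1 = (size w).+2 + size w by lia.
rewrite iterD.
have := rewind_phase (leqnn (size w)); rewrite [iter (size w).+2 _ _]iterS /=.
case: (step (iter _ _ _)) => q con hd /= [-> Eh Ec].
rewrite /step /= ffunE /= Ec Eh.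
have -> : (Posz (size w) - Posz (size w).+1)%R = (-1)%R by lia.
split=> //= [x|i z]; first by rewrite ffunE Eh; lia.
by rewrite ffunE /= Ec; case: eqP => [->|].
Qed.

Lemma simulates_step c s : simulates c s -> simulates (step c) (astep w s).
Proof.
case: c s => q con hd [[q'|b] h] [/= -> Eh Ec]; last by [].
rewrite /step /astep /=.
set rd := finfun _; set rd' := finfun _.
have -> : rd = rd'.
  apply/ffunP => x; rewrite !ffunE /= Eh Ec /input_cell.
  by case: (letter_at w _).
case: (adelta q' rd') => s mv /=; split=> //= [x|i z].
  by rewrite ffunE Eh liftK enum_rankK.
by rewrite ffunE /= Ec; case: eqP => [->|].
Qed.

Lemma compile_answer T b h :
    reach w T (inl (astart M), [ffun=> Posz 0]) (inr b, h) ->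
  forall t, T + 2 * (size w).+1 <= t -> answer compile w t = Some b.
Proof.
move=> halts t leTt.
have sim t0 : simulates (iter (t0 + 2 * (size w).+1) (@step A compile)
    (init compile w)) (iter t0 (@astep A H M w) (inl (astart M), [ffun=> Posz 0])).
  elim: t0 => [|t0 IH]; first exact: simulates_start.
  by rewrite addSn !iterS; apply: simulates_step.
have := sim (t - 2 * (size w).+1); rewrite subnK; last by lia.
rewrite (reach_iter (reach_mono halts _)); last by lia.
by case=> /= Ec _ _; rewrite /answer Ec.
Qed.

End Compilation.

(** * Definable queries *)

Section Definable.
Variable V : finType.
Implicit Types (S xs : seq V) (x y : V) (e : {ffun V -> nat}).

(* A property of a graph (vertices [0, ..., n - 1], adjacency [r]) and of an
   assignment of vertices to variables. *)
Definition query := nat -> rel nat -> {ffun V -> nat} -> bool.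

(* The variables in [S] are free; the others are parked at 0, ready to be
   quantified over. *)
Definition valid n S e := [forall v, if v \in S then e v < n else e v == 0].

(** Requiring the heads to come back to [pos n e] makes the automata composable. The base [n.+2] is
    at least 2, so the bound is monotone in [d] even for the empty graph. *)
Definition definable S (P : query) := exists M c d, forall n r e, valid n S e ->
  reach (M := M) (rows n r) (c * n.+2 ^ d)
    (inl (astart M), pos n e) (inr (P n r e), pos n e).

Definition ex_query x (P : query) : query :=
  fun n r e => has (fun a => P n r (upd e x a)) (iota 0 n).

Definition all_query x (P : query) : query :=
  fun n r e => all (fun a => P n r (upd e x a)) (iota 0 n).

Lemma definable_const S b : definable S (fun _ _ _ => b).
Proof.
exists (const_gadget V b), 1, 0 => n r e _.
apply: (@reach_move _ _ (const_gadget V b) _ 0 _ _ (inr b) (fun=> MStay) (pos n e));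
  last exact: reach_refl.
- by [].
- by move=> i; rewrite GRing.addr0.
Qed.

Lemma definable_adj S x y : x \in S -> y \in S ->
  definable S (fun n r e => r (e x) (e y)).
Proof.
move=> Sx Sy; exists (adj_gadget x y), 3, 1 => n r e /forallP ok.
have := ok x; have := ok y; rewrite Sx Sy => lty ltx.
by apply: reach_mono (adj_gadget_reach r ltx lty) _; lia.
Qed.

Lemma definable_not S P :
  definable S P -> definable S (fun n r e => ~~ P n r e).
Proof.
case=> M [c [d MP]]; exists (not_gadget M), c, d => n r e ok.
have emb q rd : adelta (q : astate (not_gadget M)) rd =
    (embed (M := M) (M' := not_gadget M) id (fun b => inr (~~ b))
       (adelta (a := M) q rd).1,
     (adelta (a := M) q rd).2).
  by rewrite /=; case: (adelta _ _) => -[].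
by have := @reach_embed _ _ M (not_gadget M) _ id _ emb _ _ _ _ _ (MP n r e ok).
Qed.

Lemma definable_and S P Q : definable S P -> definable S Q ->
  definable S (fun n r e => P n r e && Q n r e).
Proof.
case=> M [c [d MP]] [M' [c' [d' MQ]]].
pose N := and_gadget M M'.
exists N, (c + c'), (d + d') => n r e ok.
pose exit b : astate N + bool :=
  if b then inl (inr (astart M')) else inr false.
have embl q rd : adelta (inl q : astate N) rd =
    (embed (M := M) (M' := N) inl exit (adelta q rd).1, (adelta q rd).2).
  by rewrite /=; case: (adelta _ _) => -[].
have embr q rd : adelta (inr q : astate N) rd =
    (embed (M := M') (M' := N) inr inr (adelta q rd).1, (adelta q rd).2).
  by rewrite /=; case: (adelta _ _) => -[].
have {MP} := reach_embed embl (MP n r e ok).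
have {MQ} := reach_embed embr (MQ n r e ok).
rewrite /= /exit; case: (P n r e) => /= redQ redP.
  apply: reach_mono (reach_trans redP redQ) _.
  by rewrite mulnDl leq_add // leq_mul // leq_pexp2l // ?leq_addl ?leq_addr.
apply: reach_mono redP _.
by rewrite leq_mul ?leq_addr // leq_pexp2l // leq_addr.
Qed.

Lemma definable_ex_query S x P : x \notin S -> definable (x :: S) P ->
  definable S (ex_query x P).
Proof.
move=> Sx [M [c [d MP]]]; exists (ex_gadget x M), (c + 4), d.+2 => n r e ok.
have ex0 : e x = 0 by have /forallP/(_ x) := ok; rewrite (negPf Sx) => /eqP.
have body a : a < n -> reach (M := M) (rows n r) (c * n.+2 ^ d)
    (inl (astart M), pos n (upd e x a))
    (inr (P n r (upd e x a)), pos n (upd e x a)).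
  move=> ltan; apply: MP; apply/forallP => v; rewrite ffunE in_cons.
  by case: eqP => //= _; have /forallP/(_ v) := ok.
apply: reach_mono (ex_gadget_reach ex0 body) _.
(* The [n] runs of the body are charged to [c], and the quadratic cost of testing, advancing and
   rewinding to the extra 4. *)
rewrite mulnDr mulnCA mulnDl -!addnA leq_add //.
  by rewrite leq_mul // !expnS mulnA leq_mul //; nia.
have : n.+2 ^ 2 <= n.+2 ^ d.+2 by rewrite leq_pexp2l.
by nia.
Qed.

(** The list [s] is fixed in advance: this is a finite conjunction built into the automaton, not a
    quantifier over vertices. *)
Lemma definable_all S (I : Type) (s : seq I) (F : I -> query) :
  (forall i, definable S (F i)) ->
  definable S (fun n r e => all (fun i => F i n r e) s).
Proof.
move=> defF; elim: s => [|i s IH] /=; first exact: definable_const.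
exact: (definable_and (defF i) IH).
Qed.

Lemma definable_ext S P Q : (forall n r e, P n r e = Q n r e) ->
  definable S P -> definable S Q.
Proof.
by move=> PQ [M [c [d MP]]]; exists M, c, d => n r e; rewrite -PQ; apply: MP.
Qed.

Lemma definable_or S P Q : definable S P -> definable S Q ->
  definable S (fun n r e => P n r e || Q n r e).
Proof.
move=> defP defQ; apply: definable_ext
  (definable_not (definable_and (definable_not defP) (definable_not defQ))).
by move=> n r e; rewrite negb_and !negbK.
Qed.

Lemma definable_has S (I : Type) (s : seq I) (F : I -> query) :
  (forall i, definable S (F i)) ->
  definable S (fun n r e => has (fun i => F i n r e) s).
Proof.
move=> defF; elim: s => [|i s IH] /=; first exact: definable_const.
exact: (definable_or (defF i) IH).
Qed.

Lemma definable_all_query S x P : x \notin S -> definable (x :: S) P ->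
  definable S (all_query x P).
Proof.
move=> Sx defP; apply: definable_ext
  (definable_not (definable_ex_query Sx (definable_not defP))).
by move=> n r e; rewrite /ex_query has_predC negbK.
Qed.

(** [foldr] binds the head of [xs] outermost, so the variables enter the scope in reverse order,
    whence [catrev]. Uniqueness ensures that each one is still parked when it gets quantified. *)
Lemma definable_ex_queries S xs P :
  uniq (catrev xs S) -> definable (catrev xs S) P ->
  definable S (foldr ex_query P xs).
Proof.
elim: xs S => [//|x xs IH] S /= uS /(IH _ uS).
apply: definable_ex_query; move: uS.
by rewrite catrevE cat_uniq => /and3P[_ _ /andP[]].
Qed.

Lemma ex_queriesP xs (P : query) n r e : reflect
  (exists e', [/\ forall v, v \notin xs -> e' v = e v,
                  forall v, v \in xs -> e' v < n & P n r e'])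
  (foldr ex_query P xs n r e).
Proof.
apply: (iffP idP) => [|[e' [out ins Pe']]].
  elim: xs e => [|x xs IH] e /=; first by exists e.
  case/hasP => a; rewrite mem_iota => lta /IH[e' [out ins Pe']]; exists e'.
  split=> // v; rewrite in_cons.
    by rewrite negb_or => /andP[vx /out]; rewrite ffunE (negPf vx).
  case/orP => [/eqP-> | /ins //].
  by have [/ins//|/out ->] := boolP (x \in xs); rewrite ffunE eqxx.
elim: xs e out ins => [|x xs IH] e /= out ins.
  by suff <- : e' = e by []; apply/ffunP => v; exact: out.
apply/hasP; exists (e' x); first by rewrite mem_iota ins ?mem_head.
apply: IH => v; last by move=> xv; apply: ins; rewrite in_cons xv orbT.
by move=> xv; rewrite ffunE; case: eqP => [->//|/eqP xv'];
  rewrite out // in_cons negb_or xv'.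
Qed.

End Definable.

(** Without free variables every head starts on cell 0, as in the initial configuration of the
    simulating machine. *)
Lemma definable_poly_time (V : finType) (P : query V) : definable [::] P ->
  exists (M : tm (option bool)) c d, forall n r,
    answer M (rows n r) (c * size (rows n r) ^ d + c)
    = Some (P n r [ffun=> 0]).
Proof.
(* With [L] the input length, [n.+2] is at most [3 * L] once [n] is positive, which gives the factor
   [3 ^ d]. The 4 pays for copying and rewinding, where exponent [d.+1] ensures that [L] is at most
   [L ^ d.+1]; for [L = 0] the additive constant suffices. *)
case=> M [c [d MP]]; exists (compile M), (c * 3 ^ d + 4), d.+1 => n r.
have ok : valid n [::] ([ffun=> 0] : {ffun V -> nat}).
  by apply/forallP => v; rewrite ffunE.
have start : pos n ([ffun=> 0] : {ffun V -> nat}) = [ffun=> Posz 0].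
  by apply/ffunP => i; rewrite !ffunE; case: ifP.
have := MP n r _ ok; rewrite start => /compile_answer; apply.
rewrite size_rows; set L := n * n.+1.
case: n @L {ok start} => [|n] L.
  rewrite /L mul0n exp0n // !muln0 add0n leq_add // leq_mul //.
  by case: (d) => // d'; rewrite leq_exp2r.
have L_gt0 : 0 < L by [].
have leL : L <= L ^ d.+1 by rewrite expnS leq_pmulr // expn_gt0 L_gt0.
have : n.+3 ^ d <= 3 ^ d * L ^ d.+1.
  apply: (@leq_trans ((3 * L) ^ d)).
    by case: (d) => // d'; rewrite leq_exp2r // /L; nia.
  by rewrite expnMn leq_mul // leq_pexp2l.
by move: (3 ^ d) (n.+3 ^ d) (L ^ d.+1) leL => a b l; nia.
Qed.

(** * Total domination *)

Section TotalDomination.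
Variable G : sgraph.
Implicit Types (S T : {set vertex G}) (u v : vertex G).

Lemma tdsP S : reflect (forall u, exists2 v, v \in S & adj u v) (tds S).
Proof.
apply: (iffP forallP) => dom u; first exact/exists_inP.
by apply/exists_inP; apply: dom.
Qed.

Lemma tds_setT : no_isolated G -> tds [set: vertex G].
Proof.
move=> /forallP dom; apply/tdsP => u.
by have /existsP[v uv] := dom u; exists v.
Qed.

(** The tuple has length [k.+1] whatever [m] is, so that it can share its variables with the tuple
    [f] of [private_witness]. *)
Definition dominates_within (k m : nat) (f : {ffun 'I_k.+1 -> vertex G}) :=
  [forall u, exists i : 'I_k.+1, (i < m) && adj u (f i)].

(* The [g i] are private neighbours of the [f i], and they remain private in the
   total dominating set made of the [f i] and of all the vertices not adjacent
   to any [g i]. *)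
Definition private_witness (k : nat) (f g : {ffun 'I_k.+1 -> vertex G}) :=
  [forall i, forall j, adj (g i) (f j) == (i == j)] &&
  [forall u, [exists i, adj u (f i)]
          || [exists y, adj u y && [forall i, ~~ adj (g i) y]]].

(** By minimality [S :\ v] leaves some [w] without a neighbour; as [S] does dominate [w], its only
    neighbour in [S] is [v]. *)
Lemma min_tds_private S v : min_tds S -> v \in S ->
  exists w, forall u, u \in S -> adj w u = (u == v).
Proof.
case/minsetP => domS minS Sv.
have : ~~ tds (S :\ v).
  apply/negP => /minS /(_ (subsetDl _ _)) /setP/(_ v).
  by rewrite !inE eqxx Sv.
case/forallPn => w /exists_inPn wS; exists w => u Su.
have [->|uv] := eqVneq u v.
  have /tdsP/(_ w)[u' Su' wu'] := domS.
  have [<- //|u'v] := eqVneq u' v.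
  by have := wS u'; rewrite !inE u'v Su' wu' => /(_ isT).
by apply/negbTE/wS; rewrite !inE uv.
Qed.

Lemma min_tds_witness k S : min_tds S -> k < #|S| ->
  exists f g : {ffun 'I_k.+1 -> vertex G}, private_witness f g.
Proof.
move=> minS ltk; have /minsetP[/tdsP domS _] := minS.
pose f : {ffun 'I_k.+1 -> vertex G} := [ffun i => enum_val (widen_ord ltk i)].
have Sf i : f i \in S by rewrite ffunE enum_valP.
have f_inj : injective f.
  by move=> i j; rewrite !ffunE => /enum_val_inj/(congr1 val) /= /val_inj.
have /fin_all_exists[g gP] :
    forall i, exists w, forall u, u \in S -> adj w u = (u == f i).
  by move=> i; apply: min_tds_private.
exists f, (finfun g); apply/andP; split.
  apply/forallP => i; apply/forallP => j.
  by rewrite ffunE gP // (inj_eq f_inj) [j == i]eq_sym.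
apply/forallP => u; have [y Sy uy] := domS u.
have [/existsP[i /eqP yi]|/existsPn yf] := boolP [exists i, y == f i].
  by apply/orP; left; apply/existsP; exists i; rewrite -yi.
apply/orP; right; apply/existsP; exists y; rewrite uy; apply/forallP => i.
by rewrite ffunE gP.
Qed.

Lemma witness_min_tds k (f g : {ffun 'I_k.+1 -> vertex G}) :
  private_witness f g -> exists2 S : {set vertex G}, min_tds S & k < #|S|.
Proof.
case/andP => /forallP priv /forallP dom.
have {}priv i j : adj (g i) (f j) = (i == j).
  by apply/eqP; have /forallP := priv i.
pose T := [set y | [exists i, y == f i] || [forall i, ~~ adj (g i) y]].
have domT : tds T.
  apply/tdsP => u; have /orP[/existsP[i ui]|/existsP[y /andP[uy yg]]] := dom u.
    by exists (f i); rewrite // inE; apply/orP; left; apply/existsP; exists i.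
  by exists y; rewrite // inE yg orbT.
have [S minS ST] := minset_exists (P := @tds G) domT.
exists S => //; have /minsetP[/tdsP domS _] := minS.
have Sf i : f i \in S.
  (* The neighbour [y] of [g i] in [S] lies in [T]. Being adjacent to [g i] it is not of the second
     kind, so it is some [f j], and then [j = i]. *)
  have [y Sy gy] := domS (g i); have := subsetP ST _ Sy.
  rewrite inE => /orP[/existsP[j /eqP yj]|/forallP/(_ i)]; last by rewrite gy.
  by move: gy Sy; rewrite yj priv => /eqP ->.
have f_inj : injective f by move=> i j fij; apply/eqP; rewrite -priv -fij priv.
rewrite -[k.+1]card_ord -(card_codom f_inj); apply: subset_leq_card.
by apply/subsetP => _ /codomP[i ->].
Qed.

Lemma small_tds k m : 0 < Defs.order G -> m <= k.+1 ->
  (exists2 S : {set vertex G}, tds S & #|S| <= m) <->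
  (exists f : {ffun 'I_k.+1 -> vertex G}, dominates_within m f).
Proof.
move=> G_gt0 lemk; split=> [[S /tdsP domS leSm]|[f /forallP dom]].
  (* A set with fewer than [k.+1] elements is padded with vertex 0, which exists since the graph is
     nonempty. *)
  exists [ffun i => nth (Ordinal G_gt0) (enum S) (nat_of_ord i)].
  apply/forallP => u; have [v Sv uv] := domS u.
  have lti : index v (enum S) < #|S| by rewrite cardE index_mem mem_enum.
  have ltk := leq_trans (leq_trans lti leSm) lemk.
  apply/existsP; exists (Ordinal ltk); rewrite /= (leq_trans lti leSm) ffunE.
  by rewrite /= nth_index ?mem_enum.
exists [set f (widen_ord lemk i) | i in 'I_m]; last first.
  by rewrite -[X in _ <= X]card_ord leq_imset_card.
apply/tdsP => u; have /existsP[i /andP[lti ui]] := dom u.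
exists (f i) => //; apply/imsetP; exists (Ordinal lti) => //.
by congr (f _); apply: val_inj.
Qed.

(** Nonemptiness has to be stated: the empty graph has total domination number 0, but having no
    tuples of vertices it satisfies the other two conditions vacuously. *)
Lemma wtdk_witness k : 0 < k -> no_isolated G ->
  wtdk k G = [&& 0 < Defs.order G,
    ~~ [exists f : {ffun 'I_k.+1 -> vertex G}, dominates_within k.-1 f] &
    ~~ [exists f : {ffun 'I_k.+1 -> vertex G},
         exists g : {ffun 'I_k.+1 -> vertex G}, private_witness f g]].
Proof.
move=> k_gt0 noiso; have domT := tds_setT noiso; have lek : k.-1 <= k.+1 by lia.
rewrite /wtdk /gamma_t; case: arg_minnP => // S domS leS.
(* A total dominating set of least size is minimal for inclusion, so [gamma_t] is itself the size of
   a minimal set. *)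
have minS : min_tds S.
  apply/minsetP; split=> // T domT' TS; apply/eqP.
  by rewrite eqEcard TS leS.
apply/andP/and3P => [[/forallP wtdG /eqP cardS]|[G_gt0 nosmall nobig]].
  have G_gt0 : 0 < Defs.order G.
    by rewrite -[Defs.order G]card_ord -cardsT (leq_trans k_gt0) // -cardS leS.
  split=> //; apply/negP.
    case/existsP => f domf.
    have [T /leS leT] := (small_tds G_gt0 lek).2 (ex_intro _ f domf).
    by lia.
  case/existsP => f /existsP[g /witness_min_tds[T minT ltT]].
  have /forallP/(_ T)/implyP/(_ minS)/implyP/(_ minT)/eqP := wtdG S.
  by lia.
have card_min T : min_tds T -> #|T| = k.
  move=> minT; have /minsetP[domT' _] := minT.
  apply/eqP; rewrite eqn_leq; apply/andP; split.
    rewrite leqNgt; apply: contra nobig => /(min_tds_witness minT)[f [g fg]].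
    by apply/existsP; exists f; apply/existsP; exists g.
  rewrite leqNgt; apply: contra nosmall => ltT.
  have leT : #|T| <= k.-1 by lia.
  have [f domf] := (small_tds G_gt0 lek).1 (ex_intro2 _ _ T domT' leT).
  by apply/existsP; exists f.
split; last by rewrite card_min.
apply/forallP => S1; apply/forallP => S2; apply/implyP => min1.
by apply/implyP => min2; rewrite !card_min.
Qed.

End TotalDomination.

(** * Graphs as relations on natural numbers *)

Definition nat_adj (G : sgraph) : rel nat := fun u v =>
  if insub u is Some a then
    if insub v is Some b then @Defs.adj G a b else false
  else false.

Lemma nat_adjE (G : sgraph) (u v : vertex G) : nat_adj G u v = adj u v.
Proof. by rewrite /nat_adj !valK. Qed.

Lemma encode_rows (G : sgraph) : encode G = rows (Defs.order G) (nat_adj G).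
Proof.
rewrite /encode /rows -val_enum_ord -map_comp; congr flatten.
apply: eq_map => u /=; rewrite /adj_row -val_enum_ord -map_comp; congr rcons.
by apply: eq_map => v /=; rewrite nat_adjE.
Qed.

Lemma has_iota_ord n (p : pred nat) : has p (iota 0 n) = [exists a : 'I_n, p a].
Proof.
rewrite -val_enum_ord has_map; apply/hasP/existsP => [[a _ pa]|[a pa]].
  by exists a.
by exists a; rewrite ?mem_enum.
Qed.

Lemma all_iota_ord n (p : pred nat) : all p (iota 0 n) = [forall a : 'I_n, p a].
Proof.
rewrite -val_enum_ord all_map; apply/allP/forallP => pa a; first exact/pa/mem_enum.
by move=> _; apply: pa.
Qed.

Lemma has_enum (T : finType) (p : pred T) : has p (enum T) = [exists x, p x].
Proof.
apply/hasP/existsP => [[x _ px]|[x px]]; exists x => //; exact: mem_enum.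
Qed.

Lemma all_enum (T : finType) (p : pred T) : all p (enum T) = [forall x, p x].
Proof.
apply/allP/forallP => px x; first exact/px/mem_enum.
by move=> _; apply: px.
Qed.

(** * The first-order query for WTD(k) graphs *)

Section Query.
Variable k : nat.

(** The number of variables, hence of heads and tapes, depends on [k] only. *)
Definition var : finType := ('I_k.+1 * bool + bool)%type.

Definition var_f (i : 'I_k.+1) : var := inl (i, true).
Definition var_g (i : 'I_k.+1) : var := inl (i, false).
Definition var_u : var := inr true.
Definition var_y : var := inr false.
Definition vars_f : seq var := [seq var_f i | i <- enum 'I_k.+1].
Definition vars_g : seq var := [seq var_g i | i <- enum 'I_k.+1].

Definition dominates_query m : query var :=
  all_query var_u (fun n r e =>
    has (fun i : 'I_k.+1 => (i < m) && r (e var_u) (e (var_f i)))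
      (enum 'I_k.+1)).

(** The second alternative in [private_witness]: it is the vertices [g i] that [y] leaves
    undominated, while [y] dominates [u]. *)
Definition undominated_query : query var :=
  ex_query var_y (fun n r e => r (e var_u) (e var_y) &&
    all (fun i => ~~ r (e (var_g i)) (e var_y)) (enum 'I_k.+1)).

Definition private_query : query var := fun n r e =>
  all (fun i => all (fun j => r (e (var_g i)) (e (var_f j)) == (i == j))
    (enum 'I_k.+1)) (enum 'I_k.+1) &&
  all_query var_u (fun n r e =>
    has (fun i => r (e var_u) (e (var_f i))) (enum 'I_k.+1) ||
    undominated_query n r e) n r e.

Definition wtdk_query : query var := fun n r e =>
  [&& ex_query var_u (fun _ _ _ => true) n r e,
      ~~ foldr (@ex_query var) (dominates_query k.-1) vars_f n r e &
      ~~ foldr (@ex_query var) private_query (vars_f ++ vars_g) n r e].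

Lemma mem_vars_f i b : (inl (i, b) \in vars_f) = b.
Proof.
apply/mapP/idP => [[j _ [_ ->]] //|]; case: b => // _.
by exists i; rewrite ?mem_enum.
Qed.

Lemma mem_vars_g i b : (inl (i, b) \in vars_g) = ~~ b.
Proof.
apply/mapP/idP => [[j _ [_ ->]] //|]; case: b => // _.
by exists i; rewrite ?mem_enum.
Qed.

Lemma mem_vars_inr b : inr b \notin vars_f ++ vars_g.
Proof. by rewrite mem_cat; apply/norP; split; apply/mapP => -[]. Qed.

Lemma uniq_vars : uniq (vars_f ++ vars_g).
Proof.
rewrite cat_uniq; apply/and3P; split.
- by rewrite map_inj_uniq ?enum_uniq // => i j [].
- by apply/hasPn => _ /mapP[i _ ->]; rewrite mem_vars_f.
- by rewrite map_inj_uniq ?enum_uniq // => i j [].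
Qed.

Lemma dominates_query_definable (S : seq var) m :
    var_u \notin S -> {subset vars_f <= S} ->
  definable S (dominates_query m).
Proof.
move=> Su Sf; apply: definable_all_query => //.
apply: (@definable_has var _ _ _ (fun (i : 'I_k.+1) n r e =>
  (i < m) && r (e var_u) (e (var_f i)))).
move=> i; apply: (definable_and (P := fun _ _ _ => i < m)).
  exact: definable_const.
by apply: definable_adj; rewrite ?mem_head // in_cons Sf ?orbT ?mem_vars_f.
Qed.

Lemma undominated_query_definable (S : seq var) :
    var_y \notin S -> var_u \in S -> {subset vars_g <= S} ->
  definable S undominated_query.
Proof.
move=> Sy Su Sg; apply: definable_ex_query => //.
apply: (definable_and (P := fun n r e => r (e var_u) (e var_y))).
  by apply: definable_adj; rewrite in_cons ?eqxx ?Su ?orbT.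
apply: (@definable_all var _ _ _ (fun (i : 'I_k.+1) n r e =>
  ~~ r (e (var_g i)) (e var_y))) => i.
apply: (definable_not (P := fun n r e => r (e (var_g i)) (e var_y))).
by apply: definable_adj; rewrite in_cons ?eqxx // Sg ?orbT ?mem_vars_g.
Qed.

Lemma private_query_definable (S : seq var) :
    var_u \notin S -> var_y \notin S -> {subset vars_f ++ vars_g <= S} ->
  definable S private_query.
Proof.
move=> Su Sy Sfg.
have Sf i : var_f i \in S by rewrite Sfg // mem_cat mem_vars_f.
have Sg i : var_g i \in S by rewrite Sfg // mem_cat mem_vars_g orbT.
apply: definable_and; last first.
  apply: definable_all_query => //; apply: definable_or.
    apply: (@definable_has var _ _ _ (fun (i : 'I_k.+1) n r e =>
      r (e var_u) (e (var_f i)))) => i.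
    by apply: definable_adj; rewrite in_cons ?eqxx // Sf orbT.
  apply: undominated_query_definable; rewrite ?mem_head //.
  move=> v vg; rewrite in_cons Sfg ?orbT // mem_cat vg orbT //.
apply: (@definable_all var _ _ _ (fun (i : 'I_k.+1) n r e =>
  all (fun j => r (e (var_g i)) (e (var_f j)) == (i == j)) (enum 'I_k.+1))) => i.
apply: (@definable_all var _ _ _ (fun (j : 'I_k.+1) n r e =>
  r (e (var_g i)) (e (var_f j)) == (i == j))) => j.
have defr := definable_adj (Sg i) (Sf j).
(* The truth value of [i == j] is known when the automaton is built, so the comparison reduces to
   adjacency or its negation. *)
case: (i == j); last first.
  by apply: definable_ext (definable_not defr) => n r e; rewrite eqbF_neg.
by apply: definable_ext defr => n r e; rewrite eqb_id.
Qed.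

Lemma wtdk_query_definable : definable [::] wtdk_query.
Proof.
have uniq_fg := uniq_vars; have := uniq_fg; rewrite cat_uniq => /andP[uniq_f _].
apply: definable_and.
  by apply: definable_ex_query => //; apply: definable_const.
apply: definable_and; apply: definable_not; apply: definable_ex_queries.
- by rewrite catrevE cats0 rev_uniq.
- apply: dominates_query_definable => [|v]; rewrite catrevE cats0 mem_rev //.
  by have := mem_vars_inr true; rewrite mem_cat => /norP[].
- by rewrite catrevE cats0 rev_uniq.
apply: private_query_definable => [||v];
  by rewrite catrevE cats0 mem_rev // mem_vars_inr.
Qed.

Section Evaluation.
Variables (G : sgraph).
Local Notation n := (Defs.order G).
Local Notation r := (nat_adj G).
Variables (f g : {ffun 'I_k.+1 -> vertex G}) (e : {ffun var -> nat}).
Hypothesis e_f : forall i, e (var_f i) = f i.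

Lemma dominates_queryE m : dominates_query m n r e = dominates_within m f.
Proof.
rewrite /dominates_query /all_query all_iota_ord; apply: eq_forallb => u.
rewrite has_enum; apply: eq_existsb => i.
by rewrite !ffunE eqxx /= e_f nat_adjE.
Qed.

Hypothesis e_g : forall i, e (var_g i) = g i.

Lemma private_queryE : private_query n r e = private_witness f g.
Proof.
rewrite /private_query all_enum; congr (_ && _).
  apply: eq_forallb => i; rewrite all_enum; apply: eq_forallb => j.
  by rewrite e_f e_g nat_adjE.
rewrite /all_query all_iota_ord; apply: eq_forallb => u; congr (_ || _).
  rewrite has_enum; apply: eq_existsb => i.
  by rewrite !ffunE eqxx /= e_f nat_adjE.
rewrite /undominated_query /ex_query has_iota_ord; apply: eq_existsb => y.
rewrite !ffunE /= nat_adjE; congr (_ && _).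
rewrite all_enum; apply: eq_forallb => i.
by rewrite !ffunE /= e_g nat_adjE.
Qed.

End Evaluation.

Lemma wtdk_queryE G e : 0 < k -> no_isolated G ->
  wtdk_query (Defs.order G) (nat_adj G) e = wtdk k G.
Proof.
move=> k_gt0 noiso; rewrite wtdk_witness // /wtdk_query.
(* Off the quantified variables the assignment must agree with [e], as [ex_queriesP] demands. *)
pose assign (f g : {ffun 'I_k.+1 -> vertex G}) : {ffun var -> nat} :=
  [ffun v => match v with
             | inl (i, b) => if b then val (f i) else val (g i)
             | inr _ => e v
             end].
congr [&& _, ~~ _ & ~~ _].
- rewrite /ex_query has_iota_ord; apply/existsP/idP => [[u _]|G_gt0].
    exact: leq_trans (ltn_ord u).
  by exists (Ordinal G_gt0).
- apply/ex_queriesP/existsP => [[e' [_ ins]]|[f]].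
    have ltf i : e' (var_f i) < Defs.order G by apply: ins; rewrite mem_vars_f.
    rewrite (@dominates_queryE _ [ffun i => Ordinal (ltf i)]).
      by eexists; eassumption.
    by move=> i; rewrite ffunE.
  pose e' : {ffun var -> nat} :=
    [ffun v => if v is inl (i, true) then val (f i) else e v].
  rewrite -(@dominates_queryE _ f e') => [fdom|i]; last by rewrite ffunE.
  exists e'; split=> // -[[i []]|b]; rewrite ?ffunE ?mem_vars_f ?ltn_ord // => fb.
  by have := mem_vars_inr b; rewrite mem_cat fb.
apply/ex_queriesP/existsP => [[e' [_ ins]]|[f /existsP[g]]].
  have ltf i : e' (var_f i) < Defs.order G.
    by apply: ins; rewrite mem_cat mem_vars_f.
  have ltg i : e' (var_g i) < Defs.order G.
    by apply: ins; rewrite mem_cat mem_vars_g orbT.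
  rewrite (@private_queryE _ [ffun i => Ordinal (ltf i)]
    [ffun i => Ordinal (ltg i)]).
  - by move=> fg; eexists; apply/existsP; eexists; exact: fg.
  - by move=> i; rewrite ffunE.
  - by move=> i; rewrite ffunE.
rewrite -(@private_queryE _ f g (assign f g)) => [fg|i|i]; try by rewrite ffunE.
exists (assign f g); split=> // -[[i []]|b];
  rewrite ?ffunE ?mem_cat ?mem_vars_f ?mem_vars_g ?ltn_ord // => fgb.
by have := mem_vars_inr b; rewrite mem_cat fgb.
Qed.

End Query.

Theorem theorem2p8 (k : nat) (k_gt0 : 0 < k) :
  poly_time_decidable encode no_isolated (wtdk k).
Proof.
have [M [c [d decM]]] := definable_poly_time (wtdk_query_definable k).
exists M, c, d => G noiso.
by rewrite encode_rows decM wtdk_queryE.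
Qed.
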